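(* Let $X$ be an infinite dimensional complex Banach space and let $T\in L(X)$ be of Kato-type of degree $d$. Then $d=\mathrm{dis}(T)$.
   Context: $L(X)$ is the algebra of bounded linear operators on $X$; $\mathbb N\ni0$; $\mathcal N(S)$, $\mathcal R(S)$ are the kernel and range of $S$. For a $T$-invariant subspace $M$, $T_M$ is the restriction of $T$ to $M$. $(M,N)\in Red(T)$ means that $M,N$ are closed $T$-invariant subspaces with $X=M\oplus N$. $T_{[n]}:\mathcal R(T^n)\to\mathcal R(T^n)$ is the restriction of $T$ to $\mathcal R(T^n)$. The degree of stable iteration of $T$ is $\mathrm{dis}(T)=\inf\{m\in\mathbb N:\mathcal N(T_{[m]})=\mathcal N(T_{[r]})\ \forall r\ge m\}$ (with $\inf\emptyset=\infty$). An operator $S$ on a Banach space is semi-regular if $\mathcal R(S)$ is closed and $\mathrm{dis}(S)=0$. $T$ is of Kato-type of degree $d$ if there exists $(M,N)\in Red(T)$ such that $T_M$ is semi-regular and $T_N$ is nilpotent of degree $d$, i.e. $d$ is the least element of $\mathbb N$ with $T_N^d=0$ ($d=0$ if $N=\{0\}$). *)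

(* Defs.v *)
(* An operator on a subspace D of X is represented by the pair of the set D and
   a map S : X -> X leaving D invariant. With this encoding the restriction of
   T to an invariant subspace M is the pair (M, T), and the operator T on X
   itself is the pair (setT, T). *)
From HB Require Import structures.
From mathcomp Require Import all_boot all_order all_algebra.
From mathcomp Require Import all_classical all_reals all_analysis.
From mathcomp Require Export complex.

Set Implicit Arguments.
Unset Strict Implicit.
Unset Printing Implicit Defensive.

Import Order.TTheory GRing.Theory Num.Theory.
Import numFieldNormedType.Exports.

Local Open Scope classical_set_scope.
Local Open Scope ring_scope.

Section Operators.
Context {R : realType} {X : completeNormedModType R[i]}.
Implicit Types (D M N : set X) (S T : X -> X).

Definition finite_dimensional : Prop :=
  exists (n : nat) (e : 'I_n -> X),
    forall x : X, exists c : 'I_n -> R[i], x = \sum_(i < n) c i *: e i.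

(* Norms take their values in R[i]; if X is nonzero, such a C is necessarily
   a nonnegative real. *)
Definition bounded_operator T : Prop :=
  exists C : R[i], forall x : X, `|T x| <= C * `|x|.

Definition op_pow (n : nat) S : X -> X := iter n S.

Definition op_ker D S : set X := [set x | D x /\ S x = 0].

Definition op_range D S : set X := S @` D.

(* The operator induced by S on R(S^n), for S acting on D, is the pair
   (iter_range D S n, S). *)
Definition iter_range D S (n : nat) : set X := op_range D (op_pow n S).

(* dis takes values in the extended reals, where the infimum of the empty set
   is +oo. *)
Definition dis D S : \bar R :=
  ereal_inf [set (m%:R)%:E | m in
    [set m : nat | forall r : nat, (m <= r)%N ->
       op_ker (iter_range D S m) S = op_ker (iter_range D S r) S]].

(* Closedness of the range is relative to the space D on which S acts. *)
Definition semi_regular D S : Prop :=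
  closed (op_range D S : set (subspace D)) /\ dis D S = 0%E.

Definition nilpotent_of_degree D S (d : nat) : Prop :=
  (forall x, D x -> op_pow d S x = 0) /\
  (forall k : nat, (forall x, D x -> op_pow k S x = 0) -> (d <= k)%N).

Definition closed_invariant_subspace T M : Prop :=
  [/\ submod_closed [in M], closed M & T @` M `<=` M].

Definition direct_sum M N : Prop :=
  (forall x : X, exists u v : X, [/\ M u, N v & x = u + v]) /\
  M `&` N = [set 0].

Definition Red T M N : Prop :=
  [/\ closed_invariant_subspace T M, closed_invariant_subspace T N
    & direct_sum M N].

Definition kato_type_of_degree T (d : nat) : Prop :=
  exists M N : set X,
    [/\ Red T M N, semi_regular M T & nilpotent_of_degree N T d].

End Operators.

Arguments finite_dimensional {R} X.

(* Main.v *)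
Require Import Defs.
From mathcomp Require Import all_boot all_order all_algebra.
From mathcomp Require Import all_classical all_reals all_analysis.

Import numFieldNormedType.Exports.
Import Order.TTheory GRing.Theory Num.Theory.

Local Open Scope classical_set_scope.
Local Open Scope ring_scope.

(** For [X = M (+) N] with both summands invariant, the space
    [N(T) `&` R(T^m)] is the direct sum of its analogues for [T_M] and [T_N]
    ([op_ker_iter_range_sum]). Semi-regularity of [T_M] makes the [M]-summand
    independent of [m] ([dis0_stable]), so only the [N]-summand can vary. If
    [T_N] is nilpotent of degree [d], that summand is zero for [m >= d], while
    for [m < d] it contains [T^(d-1) N], which is not zero. Hence the sequence
    is stationary from [m] on exactly when [m >= d], and the infimum of these
    [m] is [d]. *)

Section StableIteration.
Context {R : realType} {X : completeNormedModType R[i]}.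
Implicit Types (D : set X) (S : X -> X).

Definition stable_from D S (m : nat) : Prop :=
  forall r, (m <= r)%N ->
    op_ker (iter_range D S m) S = op_ker (iter_range D S r) S.

(** The infimum defining [dis] is over extended reals; being below [1] forces
    it to be witnessed by the integer [0]. *)
Lemma dis0_stable {D S} : dis D S = 0%E -> stable_from D S 0.
Proof.
move=> dis0; have : (dis D S < 1)%E by rewrite dis0 lte_fin ltr01.
move=> /ereal_inf_lt[_ [m m_stable <-]].
by rewrite lte_fin (ltr_nat _ m 1) ltnS leqn0 => /eqP m0;
  rewrite m0 in m_stable.
Qed.

Lemma dis_stable {D S d} :
  (forall m, stable_from D S m <-> (d <= m)%N) -> dis D S = (d%:R)%:E.
Proof.
move=> stableE; apply/eqP; rewrite eq_le; apply/andP; split.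
  by apply: ereal_inf_lbound; exists d => //; apply/stableE.
apply: le_ereal_inf_tmp => _ [m m_stable <-].
by rewrite lee_fin ler_nat; apply/stableE.
Qed.

End StableIteration.

Section InvariantSubspaces.
Context {R : realType} {X : completeNormedModType R[i]}.
Variable T : {linear X -> X}.
Implicit Types (M N : set X).

Lemma op_pow0 n : op_pow n T 0 = 0.
Proof. by elim: n => //= n ->; rewrite linear0. Qed.

Lemma op_powD n x y : op_pow n T (x + y) = op_pow n T x + op_pow n T y.
Proof. by elim: n => //= n ->; rewrite linearD. Qed.

Lemma invariant0 {M} : closed_invariant_subspace T M -> M 0.
Proof. by case=> -[+ _] _ _; rewrite inE. Qed.

Lemma invariantN {M} x : closed_invariant_subspace T M -> M x -> M (- x).
Proof.
move=> Minv Mx; have M0 := invariant0 Minv; case: Minv => -[_ Mlin] _ _.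
have := Mlin (-1) x 0; rewrite !inE addr0 scaleN1r.
exact.
Qed.

Lemma invariant_op_pow {M} n x :
  closed_invariant_subspace T M -> M x -> M (op_pow n T x).
Proof.
by case=> _ _ TM Mx; elim: n => //= n IHn; apply: TM; exists (op_pow n T x).
Qed.

(** The splitting of [R(T^m)] is inherited by the kernel: if
    [T u + T v = 0] with [u] in [M] and [v] in [N], then [T u = - T v] lies in
    both summands. *)
Lemma op_ker_iter_range_sum {M N m x} : Red T M N ->
  op_ker (iter_range setT T m) T x <->
  exists u v, [/\ op_ker (iter_range M T m) T u,
                  op_ker (iter_range N T m) T v & x = u + v].
Proof.
move=> [Minv Ninv [MN_sum MN0]]; split.
  move=> [[y _ <-]]; have [a [b [Ma Nb ->]]] := MN_sum y.
  rewrite op_powD linearD => Tab0.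
  have Tb : T (op_pow m T b) = - T (op_pow m T a).
    by apply/eqP; rewrite -addr_eq0 addrC; apply/eqP.
  have Ta0 : T (op_pow m T a) = 0.
    have : (M `&` N) (T (op_pow m T a)).
      split; first exact: (invariant_op_pow m.+1).
      rewrite -[T _]opprK -Tb; apply: invariantN => //.
      exact: (invariant_op_pow m.+1).
    by rewrite MN0.
  exists (op_pow m T a), (op_pow m T b).
  by split=> //; split=> //; [exists a | exists b | rewrite Tb Ta0 oppr0].
move=> [_ [_ [[[a _ <-] Ta0] [[b _ <-] Tb0] ->]]].
split; first by exists (a + b) => //; rewrite op_powD.
by rewrite linearD Ta0 Tb0 addr0.
Qed.

Lemma iter_range_nilpotent {N d m x} : nilpotent_of_degree N T d ->
  (d <= m)%N -> iter_range N T m x -> x = 0.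
Proof.
move=> [Nd0 _] dm [y Ny <-].
by rewrite -(subnK dm) /op_pow iterD -/(op_pow d T y) Nd0 // [LHS]op_pow0.
Qed.

(** The witness is a nonzero [T^(d-1) y] with [y] in [N]: it lies in
    [R(T_N^m)] for every [m <= d - 1]. *)
Lemma op_ker_iter_range_nilpotent {N d m} :
  closed_invariant_subspace T N -> nilpotent_of_degree N T d -> (m < d)%N ->
  exists2 x, op_ker (iter_range N T m) T x & x <> 0.
Proof.
move=> Ninv; case: d => // d [Nd0 d_min]; rewrite ltnS => md.
have /existsNP[y /not_implyP[Ny y_neq0]] :
    ~ forall x, N x -> op_pow d T x = 0.
  by move=> /d_min; rewrite ltnn.
exists (op_pow d T y) => //; split; last exact: Nd0.
exists (op_pow (d - m) T y); first exact: invariant_op_pow.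
by rewrite /op_pow -iterD subnKC.
Qed.

Lemma stable_from_nilpotent_sum {M N d m} : Red T M N -> stable_from M T 0 ->
  nilpotent_of_degree N T d -> stable_from setT T m <-> (d <= m)%N.
Proof.
move=> MN M_stable Nd; have [Minv Ninv [_ MN0]] := MN.
have N0 k : op_ker (iter_range N T k) T 0.
  split; last exact: linear0.
  by exists 0; [exact: invariant0 | exact: op_pow0].
split.
  move=> m_stable; rewrite leqNgt; apply/negP => md.
  have [x [[y Ny yx] Tx0]] := op_ker_iter_range_nilpotent Ninv Nd md; apply.
  have Nx : N x by rewrite -yx; exact: invariant_op_pow.
  (* By stability x also lies in R(T^d), which is contained in M. *)
  have : op_ker (iter_range setT T d) T x.
    by rewrite -(m_stable _ (ltnW md)); split=> //; exists y.
  move=> /(op_ker_iter_range_sum MN)[u [v [[[a Ma au] _] [vd _] xuv]]].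
  have Mx : M x.
    rewrite xuv (iter_range_nilpotent Nd (leqnn d) vd) addr0 -au.
    exact: invariant_op_pow.
  by have : (M `&` N) x by []; rewrite MN0.
move=> dm r mr; apply/seteqP.
have sub k l : (d <= k)%N -> op_ker (iter_range setT T k) T `<=`
    op_ker (iter_range setT T l) T.
  move=> dk x /(op_ker_iter_range_sum MN)[u [v [Mu [vk _] ->]]].
  apply/(op_ker_iter_range_sum MN); exists u, 0; split=> //.
    by rewrite -(M_stable l) // (M_stable k).
  by rewrite (iter_range_nilpotent Nd dk vk).
by split; apply: sub => //; exact: leq_trans mr.
Qed.

End InvariantSubspaces.

Theorem theorem2p21 (R : realType) (X : completeNormedModType R[i])
    (hX : ~ finite_dimensional X)
    (T : {linear X -> X}) (hT : bounded_operator T)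
    (d : nat) (hd : kato_type_of_degree T d) :
  (d%:R)%:E = dis setT T.
Proof.
have [M [N [MN [_ /dis0_stable M_stable] Nd]]] := hd.
apply/esym/dis_stable => m.
exact: stable_from_nilpotent_sum MN M_stable Nd.
Qed.
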